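(* There are no minimal translation surfaces $X:I\times J\to\mathbb{S}^3$, $X(s,t)=\alpha(s)\cdot\beta(t)$ ($\alpha,\beta$ arc length curves in $\mathbb{S}^3$), for which $\kappa_\alpha\neq0$, $\kappa_\beta\neq0$, $\tau_\alpha$ and $\tau_\beta$ are all constant.
   Context: $\mathbb{R}^4$ is identified with the quaternions, ''$\cdot$'' is quaternion multiplication, and $\mathbb{S}^3$ is the group of unit quaternions with the induced metric. A translation surface is a regular surface locally parametrized by $X(s,t)=\alpha(s)\cdot\beta(t)$. For an arc length curve $\gamma$ in $\mathbb{S}^3$: $t_\gamma=\gamma'$, $\kappa_\gamma=|\nabla_{\gamma'}\gamma'|$; where $\kappa_\gamma\neq0$, $n_\gamma=\kappa_\gamma^{-1}\nabla_{\gamma'}\gamma'$, $b_\gamma\in T_\gamma\mathbb{S}^3$ is the unit vector orthogonal to $t_\gamma,n_\gamma$ with $\det(\gamma,t_\gamma,n_\gamma,b_\gamma)>0$, and the torsion $\tau_\gamma$ is defined by $\nabla_{t_\gamma}n_\gamma=-\kappa_\gamma t_\gamma+\tau_\gamma b_\gamma$. Minimal means the mean curvature in $\mathbb{S}^3$ vanishes identically. *)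

(* Defs.v *)
From Stdlib Require Import Reals.
From Coquelicot Require Import Coquelicot.
Open Scope R_scope.

(** * Quaternions, identified with R^4 through the basis 1, i, j, k *)

Record quat : Type := Quat { qre : R; qi : R; qj : R; qk : R }.

Definition qzero : quat := Quat 0 0 0 0.

Definition qadd (x y : quat) : quat :=
  Quat (qre x + qre y) (qi x + qi y) (qj x + qj y) (qk x + qk y).

Definition qscal (c : R) (x : quat) : quat :=
  Quat (c * qre x) (c * qi x) (c * qj x) (c * qk x).

Definition qsub (x y : quat) : quat := qadd x (qscal (-1) y).

Definition qmul (x y : quat) : quat :=
  Quat (qre x * qre y - qi x * qi y - qj x * qj y - qk x * qk y)
       (qre x * qi y + qi x * qre y + qj x * qk y - qk x * qj y)
       (qre x * qj y - qi x * qk y + qj x * qre y + qk x * qi y)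
       (qre x * qk y + qi x * qj y - qj x * qi y + qk x * qre y).

Definition qdot (x y : quat) : R :=
  qre x * qre y + qi x * qi y + qj x * qj y + qk x * qk y.

Definition qnorm (x : quat) : R := sqrt (qdot x x).

Definition det3 (a1 a2 a3 b1 b2 b3 c1 c2 c3 : R) : R :=
  a1 * (b2 * c3 - b3 * c2) - a2 * (b1 * c3 - b3 * c1)
  + a3 * (b1 * c2 - b2 * c1).

(* Laplace expansion along [x]. *)
Definition qdet (x y z w : quat) : R :=
  qre x * det3 (qi y) (qj y) (qk y) (qi z) (qj z) (qk z) (qi w) (qj w) (qk w)
  - qi x * det3 (qre y) (qj y) (qk y) (qre z) (qj z) (qk z)
                (qre w) (qj w) (qk w)
  + qj x * det3 (qre y) (qi y) (qk y) (qre z) (qi z) (qk z)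
                (qre w) (qi w) (qk w)
  - qk x * det3 (qre y) (qi y) (qj y) (qre z) (qi z) (qj z)
                (qre w) (qi w) (qj w).

(** * Curves in the unit sphere S^3 *)

Definition is_open_interval (I : R -> Prop) : Prop :=
  open I /\ (exists x, I x)
  /\ (forall x y z, I x -> I z -> x <= y <= z -> I y).

Definition qderiv (f : R -> quat) (s : R) : quat :=
  Quat (Derive (fun u => qre (f u)) s) (Derive (fun u => qi (f u)) s)
       (Derive (fun u => qj (f u)) s) (Derive (fun u => qk (f u)) s).

Definition class_C (k : nat) (I : R -> Prop) (f : R -> R) : Prop :=
  forall (m : nat) (s : R), (m <= k)%nat -> I s ->
    ex_derive_n f m s /\ continuous (Derive_n f m) s.

(* C^3 is the regularity needed for the torsion to be defined and continuous. *)
Definition arc_length_curve (I : R -> Prop) (g : R -> quat) : Prop :=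
  (class_C 3 I (fun u => qre (g u)) /\ class_C 3 I (fun u => qi (g u))
   /\ class_C 3 I (fun u => qj (g u)) /\ class_C 3 I (fun u => qk (g u)))
  /\ (forall s, I s -> qnorm (g s) = 1)
  /\ (forall s, I s -> qnorm (qderiv g s) = 1).

(* Levi-Civita covariant derivative in S^3 of the vector field [V] along the
   curve [g]: the projection of V' onto the orthogonal complement of g. *)
Definition cov (g V : R -> quat) (s : R) : quat :=
  qsub (qderiv V s) (qscal (qdot (qderiv V s) (g s)) (g s)).

Definition tangent (g : R -> quat) : R -> quat := qderiv g.

Definition curvature (g : R -> quat) (s : R) : R :=
  qnorm (cov g (tangent g) s).

Definition normal (g : R -> quat) (s : R) : quat :=
  qscal (/ curvature g s) (cov g (tangent g) s).

Definition is_binormal (g : R -> quat) (s : R) (b : quat) : Prop :=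
  qdot b (g s) = 0 /\ qnorm b = 1
  /\ qdot b (tangent g s) = 0 /\ qdot b (normal g s) = 0
  /\ 0 < qdet (g s) (tangent g s) (normal g s) b.

(* Meaningful only where the curvature of [g] does not vanish. *)
Definition is_torsion (g : R -> quat) (s tau : R) : Prop :=
  exists b : quat, is_binormal g s b
    /\ cov g (normal g) s
       = qadd (qscal (- curvature g s) (tangent g s)) (qscal tau b).

(** * Parametrized surfaces in S^3 *)

Definition translation (alpha beta : R -> quat) (s t : R) : quat :=
  qmul (alpha s) (beta t).

Definition d_s (X : R -> R -> quat) (s t : R) : quat :=
  qderiv (fun u => X u t) s.

Definition d_t (X : R -> R -> quat) (s t : R) : quat :=
  qderiv (fun u => X s u) t.

Definition regular_surface (I J : R -> Prop) (X : R -> R -> quat) : Prop :=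
  forall s t, I s -> J t -> forall a b : R,
    qadd (qscal a (d_s X s t)) (qscal b (d_t X s t)) = qzero ->
    a = 0 /\ b = 0.

Definition is_unit_normal (X : R -> R -> quat) (s t : R) (N : quat) : Prop :=
  qnorm N = 1 /\ qdot N (X s t) = 0
  /\ qdot N (d_s X s t) = 0 /\ qdot N (d_t X s t) = 0.

(* Mean curvature of [X] in S^3 at (s, t) with respect to the unit normal [N]:
   half the trace of the second fundamental form [h] with respect to the first
   fundamental form [E], [F], [G]. *)
Definition mean_curvature (X : R -> R -> quat) (s t : R) (N : quat) : R :=
  let E := qdot (d_s X s t) (d_s X s t) in
  let F := qdot (d_s X s t) (d_t X s t) in
  let G := qdot (d_t X s t) (d_t X s t) in
  let h_ss := qdot (cov (fun u => X u t) (fun u => d_s X u t) s) N in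
  let h_st := qdot (cov (fun u => X u t) (fun u => d_t X u t) s) N in
  let h_tt := qdot (cov (fun u => X s u) (fun u => d_t X s u) t) N in
  (G * h_ss - 2 * F * h_st + E * h_tt) / (2 * (E * G - F * F)).

(* The condition does not depend on the choice of [N], which is unique up to
   sign at a point where [X] is regular. *)
Definition minimal (I J : R -> Prop) (X : R -> R -> quat) : Prop :=
  forall s t, I s -> J t -> forall N : quat,
    is_unit_normal X s t N -> mean_curvature X s t N = 0.

(* Main.v *)
(* Write a = conj(alpha) alpha', an imaginary unit tracing a circle with
   constant speed (by the Frenet equations, since curvature and torsion are
   constant), and b = beta' conj(beta). With X_s = alpha a beta and
   X_t = alpha b beta, minimality reads
   <a' + b', a x b> = 2 <a,b> (1 - <a,b>^2).
   For fixed t the left side is a trigonometric polynomial of degree one in s,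
   while the right side is cubic in <a,b>. So <a,b> cannot depend on s: a' is
   orthogonal to b for all s and t. Differentiating in s and in t, both a' and
   a'' are orthogonal to both b and b', which is impossible in R^3 since b and b'
   are nonzero and orthogonal. *)
Require Import Defs.
From Stdlib Require Import Reals Lra Lia.
From Coquelicot Require Import Coquelicot.
Open Scope R_scope.

(** * Quaternion algebra, inner product and determinant *)

Definition qconj (x : quat) : quat := Quat (qre x) (- qi x) (- qj x) (- qk x).
Definition qone : quat := Quat 1 0 0 0.

Ltac qcoords :=
  intros; repeat match goal with x : quat |- _ => destruct x end;
  cbv [qadd qsub qscal qmul qdot qconj qone qzero qdet det3 qre qi qj qk];
  first [ring | f_equal; ring].

Lemma qmulA x y z : qmul x (qmul y z) = qmul (qmul x y) z.
Proof. qcoords. Qed.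

Lemma qmul_qscal_l c x y : qmul (qscal c x) y = qscal c (qmul x y).
Proof. qcoords. Qed.

Lemma qmul_qscal_r c x y : qmul x (qscal c y) = qscal c (qmul x y).
Proof. qcoords. Qed.

Lemma qmul_qadd_l x y z : qmul (qadd x y) z = qadd (qmul x z) (qmul y z).
Proof. qcoords. Qed.

Lemma qmul_qadd_r x y z : qmul x (qadd y z) = qadd (qmul x y) (qmul x z).
Proof. qcoords. Qed.

Lemma qmul_conj_l x : qmul (qconj x) x = qscal (qdot x x) qone.
Proof. qcoords. Qed.

Lemma qmul_conj_r x : qmul x (qconj x) = qscal (qdot x x) qone.
Proof. qcoords. Qed.

Lemma qmul_1_l x : qmul qone x = x.
Proof. qcoords. Qed.

Lemma qmul_1_r x : qmul x qone = x.
Proof. qcoords. Qed.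

Lemma qscal_1 x : qscal 1 x = x.
Proof. qcoords. Qed.

Lemma qdotC x y : qdot x y = qdot y x.
Proof. qcoords. Qed.

Lemma qdot_qadd_l x y z : qdot (qadd x y) z = qdot x z + qdot y z.
Proof. qcoords. Qed.

Lemma qdot_qadd_r x y z : qdot z (qadd x y) = qdot z x + qdot z y.
Proof. qcoords. Qed.

Lemma qdot_qscal_l c x z : qdot (qscal c x) z = c * qdot x z.
Proof. qcoords. Qed.

Lemma qdot_qscal_r c x z : qdot z (qscal c x) = c * qdot z x.
Proof. qcoords. Qed.

Lemma qdot_qsub_l x y z : qdot (qsub x y) z = qdot x z - qdot y z.
Proof. qcoords. Qed.

Lemma qdot_qmul_l c x y : qdot (qmul c x) (qmul c y) = qdot c c * qdot x y.
Proof. qcoords. Qed.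

Lemma qdot_qmul_r c x y : qdot (qmul x c) (qmul y c) = qdot c c * qdot x y.
Proof. qcoords. Qed.

Lemma qdot_conj_l x y z : qdot (qmul (qconj x) y) z = qdot y (qmul x z).
Proof. qcoords. Qed.

Lemma qdot_conj_r x y z : qdot (qmul x (qconj y)) z = qdot x (qmul z y).
Proof. qcoords. Qed.

Lemma qdot_qconj x : qdot (qconj x) (qconj x) = qdot x x.
Proof. qcoords. Qed.

(** Full polarization of the multiplicativity of the norm, |x y| = |x| |y|. *)
Lemma qdot_exchange x x1 y y1 :
  qdot (qmul x1 y1) (qmul x y) + qdot (qmul x1 y) (qmul x y1)
  = 2 * qdot x1 x * qdot y1 y.
Proof. qcoords. Qed.

Lemma qdot_self_ge0 x : 0 <= qdot x x.
Proof. unfold qdot; nra. Qed.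

Lemma qdot_self_eq0 x : qdot x x = 0 -> x = qzero.
Proof.
destruct x as [a b c d]; unfold qdot; cbn; intros H.
unfold qzero; f_equal; nra.
Qed.

Lemma qnorm_sqr x : qnorm x * qnorm x = qdot x x.
Proof. apply sqrt_sqrt, qdot_self_ge0. Qed.

(* [qdet x y z w * qdet x y z w'] is the Gram determinant of the two
   quadruples. *)
Lemma qdet_mul_orthogonal (x y z w w' : quat) :
  qdot x y = 0 -> qdot x z = 0 -> qdot y z = 0 ->
  qdot x w = 0 -> qdot y w = 0 -> qdot z w = 0 ->
  qdet x y z w * qdet x y z w' = qdot x x * qdot y y * qdot z z * qdot w w'.
Proof.
intros xy xz yz xw yw zw.
assert (D : qdet x y z w * qdet x y z w' =
  qdot x x * det3 (qdot y y) (qdot y z) (qdot y w')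
                  (qdot z y) (qdot z z) (qdot z w')
                  (qdot w y) (qdot w z) (qdot w w')
  - qdot x y * det3 (qdot y x) (qdot y z) (qdot y w')
                    (qdot z x) (qdot z z) (qdot z w')
                    (qdot w x) (qdot w z) (qdot w w')
  + qdot x z * det3 (qdot y x) (qdot y y) (qdot y w')
                    (qdot z x) (qdot z y) (qdot z w')
                    (qdot w x) (qdot w y) (qdot w w')
  - qdot x w' * det3 (qdot y x) (qdot y y) (qdot y z)
                     (qdot z x) (qdot z y) (qdot z z)
                     (qdot w x) (qdot w y) (qdot w z)).
{ clear. qcoords. }
(* The orthogonality hypotheses make the Gram matrix zero below its diagonal, so only the diagonal
   product survives. *)
rewrite D, (qdotC z y), (qdotC y x), (qdotC z x), (qdotC w x), (qdotC w y),
  (qdotC w z), xy, xz, yz, xw, yw, zw.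
unfold det3; ring.
Qed.

(** For mutually orthogonal x, y, z the correction terms vanish, so y conj(x) z is their ternary
    cross product in R^4. *)
Lemma qdet_triple_product (x y z w : quat) :
  qdet x y z w =
  qdot (qmul (qmul y (qconj x)) z) w
  - qdot y x * qdot z w - qdot x z * qdot y w + qdot y z * qdot x w.
Proof. qcoords. Qed.

(** The determinant equals <r,b> for r = y conj(x) z, and its square is the Gram determinant 1.
    Being positive, <r,b> is 1, and two unit vectors with inner product 1 coincide. *)
Lemma binormal_eq (x y z b : quat) :
  qdot x x = 1 -> qdot y y = 1 -> qdot z z = 1 -> qdot b b = 1 ->
  qdot x y = 0 -> qdot x z = 0 -> qdot y z = 0 ->
  qdot x b = 0 -> qdot y b = 0 -> qdot z b = 0 ->
  0 < qdet x y z b -> b = qmul (qmul y (qconj x)) z.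
Proof.
intros xx yy zz bb xy xz yz xb yb zb pos.
set (r := qmul (qmul y (qconj x)) z).
assert (rr : qdot r r = 1).
{ unfold r; rewrite qdot_qmul_r, qdot_qmul_l, qdot_qconj, xx, yy, zz; ring. }
assert (D := qdet_mul_orthogonal x y z b b xy xz yz xb yb zb).
assert (E := qdet_triple_product x y z b).
fold r in E; rewrite (qdotC y x), xy, xz, yz in E.
rewrite xx, yy, zz, bb in D.
assert (rb : qdot r b = 1) by nra.
assert (H : qdot (qsub b r) (qsub b r) = 0).
{ replace (qdot (qsub b r) (qsub b r))
    with (qdot b b - 2 * qdot r b + qdot r r) by (clear; generalize r; qcoords).
  lra. }
apply qdot_self_eq0 in H.
clear - H; generalize dependent r; destruct b; intros [];
unfold qsub, qadd, qscal, qzero; cbn; intros [=]; f_equal; lra.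
Qed.

(** * Differentiation of quaternion-valued functions *)

Definition is_qderiv (f : R -> quat) (s : R) (v : quat) : Prop :=
  is_derive (fun u => qre (f u)) s (qre v) /\
  is_derive (fun u => qi (f u)) s (qi v) /\
  is_derive (fun u => qj (f u)) s (qj v) /\
  is_derive (fun u => qk (f u)) s (qk v).

Ltac qsplit := split; [|split; [|split]].

Lemma is_qderiv_unique f s v : is_qderiv f s v -> qderiv f s = v.
Proof.
intros (H1 & H2 & H3 & H4); destruct v; unfold qderiv.
f_equal; now apply is_derive_unique.
Qed.

Lemma is_qderiv_ext_open (I : R -> Prop) f h s v :
  open I -> I s -> (forall u, I u -> f u = h u) ->
  is_qderiv f s v -> is_qderiv h s v.
Proof.
intros oI Is E (H1 & H2 & H3 & H4).
assert (L : locally s I) by now apply oI.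
qsplit;
  (eapply is_derive_ext_loc; [|eassumption]);
  (eapply filter_imp; [|exact L]); intros u Iu; cbn; now rewrite E.
Qed.

Lemma is_qderiv_const c s : is_qderiv (fun _ => c) s qzero.
Proof. qsplit; apply @is_derive_const. Qed.

Lemma is_derive_eq (f : R -> R) s d d' : is_derive f s d -> d = d' -> is_derive f s d'.
Proof. now intros H <-. Qed.

Lemma is_derive_mul (f h : R -> R) s d d' :
  is_derive f s d -> is_derive h s d' ->
  is_derive (fun u => f u * h u) s (d * h s + f s * d').
Proof. intros H H'; apply (is_derive_mult f h s d d' H H'); intros; apply Rmult_comm. Qed.

Ltac deriv :=
  lazymatch goal with
  | |- is_derive (fun u => _ + _) _ _ => apply @is_derive_plus; deriv
  | |- is_derive (fun u => _ - _) _ _ => apply @is_derive_minus; deriv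
  | |- is_derive (fun u => _ * _) _ _ => apply is_derive_mul; deriv
  | _ => first [eassumption | apply @is_derive_const]
  end.

Lemma is_qderiv_qadd f h s v w : is_qderiv f s v -> is_qderiv h s w ->
  is_qderiv (fun u => qadd (f u) (h u)) s (qadd v w).
Proof.
intros (H1 & H2 & H3 & H4) (K1 & K2 & K3 & K4).
qsplit; cbn; deriv.
Qed.

Lemma is_qderiv_qmul f h s v w : is_qderiv f s v -> is_qderiv h s w ->
  is_qderiv (fun u => qmul (f u) (h u)) s (qadd (qmul v (h s)) (qmul (f s) w)).
Proof.
intros (H1 & H2 & H3 & H4) (K1 & K2 & K3 & K4).
qsplit; cbn; (eapply is_derive_eq; [deriv|]);
  unfold plus, minus, opp; cbn; ring.
Qed.

Lemma is_qderiv_qconj f s v : is_qderiv f s v ->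
  is_qderiv (fun u => qconj (f u)) s (qconj v).
Proof.
intros (H1 & H2 & H3 & H4); qsplit; cbn; try assumption;
  now apply @is_derive_opp.
Qed.

Lemma is_qderiv_qscal c f s v : is_qderiv f s v ->
  is_qderiv (fun u => qscal c (f u)) s (qscal c v).
Proof.
intros (H1 & H2 & H3 & H4); qsplit; cbn; now apply @is_derive_scal.
Qed.

Lemma is_derive_qdot f h s v w : is_qderiv f s v -> is_qderiv h s w ->
  is_derive (fun u => qdot (f u) (h u)) s (qdot v (h s) + qdot (f s) w).
Proof.
intros (H1 & H2 & H3 & H4) (K1 & K2 & K3 & K4).
unfold qdot; (eapply is_derive_eq; [deriv|]);
  unfold plus; cbn; ring.
Qed.

Lemma is_derive_qdot_const f s v c : is_qderiv f s v ->
  is_derive (fun u => qdot (f u) c) s (qdot v c).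
Proof.
intros H; eapply is_derive_eq.
{ apply (is_derive_qdot f (fun _ => c) s v qzero H), is_qderiv_const. }
cbn; generalize (f s); clear; qcoords.
Qed.

Lemma is_derive_constant_on (I : R -> Prop) (f : R -> R) c s d :
  open I -> I s -> (forall u, I u -> f u = c) -> is_derive f s d -> d = 0.
Proof.
intros oI Is E H.
apply (is_derive_ext_loc _ (fun _ => c)) in H.
{ apply is_derive_unique in H; rewrite Derive_const in H; now symmetry. }
apply (filter_imp I); [exact E | now apply oI].
Qed.

(** * Arc length curves in the sphere *)

Lemma class_C_is_derive k I f m s : class_C k I f -> (S m <= k)%nat -> I s ->
  is_derive (Derive_n f m) s (Derive_n f (S m) s).
Proof. intros C le Is; apply Derive_correct, (C (S m) s le Is). Qed.

Lemma arc_length_jet I g s : arc_length_curve I g -> I s ->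
  is_qderiv g s (qderiv g s)
  /\ is_qderiv (qderiv g) s (qderiv (qderiv g) s)
  /\ is_qderiv (qderiv (qderiv g)) s (qderiv (qderiv (qderiv g)) s).
Proof.
intros ((C1 & C2 & C3 & C4) & _) Is.
(* In each coordinate, iterated [qderiv] is convertible to [Derive_n], so every component of the jet
   is an instance of [D]. *)
assert (D : forall f m, class_C 3 I f -> (m < 3)%nat ->
  is_derive (Derive_n f m) s (Derive_n f (S m) s)).
{ intros f m C lt; apply (class_C_is_derive 3 I); [exact C|lia|exact Is]. }
split; [|split]; qsplit.
- exact (D _ 0%nat C1 ltac:(lia)).
- exact (D _ 0%nat C2 ltac:(lia)).
- exact (D _ 0%nat C3 ltac:(lia)).
- exact (D _ 0%nat C4 ltac:(lia)).
- exact (D _ 1%nat C1 ltac:(lia)).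
- exact (D _ 1%nat C2 ltac:(lia)).
- exact (D _ 1%nat C3 ltac:(lia)).
- exact (D _ 1%nat C4 ltac:(lia)).
- exact (D _ 2%nat C1 ltac:(lia)).
- exact (D _ 2%nat C2 ltac:(lia)).
- exact (D _ 2%nat C3 ltac:(lia)).
- exact (D _ 2%nat C4 ltac:(lia)).
Qed.

Lemma qnorm_1 x : qnorm x = 1 -> qdot x x = 1.
Proof. intros H; rewrite <- qnorm_sqr, H; ring. Qed.

(** Everything follows by differentiating the constants <g,g> = 1 and <g',g'> = 1, then the
    relations <g',g> = 0 and <g'',g> = -1 so obtained. *)
Lemma arc_length_products I g s : open I -> arc_length_curve I g -> I s ->
  let g1 := qderiv g in let g2 := qderiv g1 in let g3 := qderiv g2 in
  qdot (g s) (g s) = 1 /\ qdot (g1 s) (g1 s) = 1 /\ qdot (g1 s) (g s) = 0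
  /\ qdot (g2 s) (g s) = -1 /\ qdot (g2 s) (g1 s) = 0 /\ qdot (g3 s) (g s) = 0.
Proof.
intros oI A Is g1 g2 g3.
assert (D : forall u, I u ->
  is_qderiv g u (g1 u) /\ is_qderiv g1 u (g2 u) /\ is_qderiv g2 u (g3 u))
  by (intros; now apply (arc_length_jet I)).
assert (A0 : forall u, I u -> qdot (g u) (g u) = 1) by (intros; now apply qnorm_1, A).
assert (A1 : forall u, I u -> qdot (g1 u) (g1 u) = 1) by (intros; now apply qnorm_1, A).
assert (B : forall u, I u -> qdot (g1 u) (g u) = 0).
{ intros u Iu; destruct (D u Iu) as (d0 & d1 & d2).
  assert (H := is_derive_constant_on I _ 1 u _ oI Iu A0 (is_derive_qdot _ _ _ _ _ d0 d0)).
  rewrite (qdotC (g u)) in H; lra. }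
assert (B1 : forall u, I u -> qdot (g2 u) (g1 u) = 0).
{ intros u Iu; destruct (D u Iu) as (d0 & d1 & d2).
  assert (H := is_derive_constant_on I _ 1 u _ oI Iu A1 (is_derive_qdot _ _ _ _ _ d1 d1)).
  rewrite (qdotC (g1 u)) in H; lra. }
assert (C : forall u, I u -> qdot (g2 u) (g u) = -1).
{ intros u Iu; destruct (D u Iu) as (d0 & d1 & d2).
  assert (H := is_derive_constant_on I _ 0 u _ oI Iu B (is_derive_qdot _ _ _ _ _ d1 d0)).
  rewrite A1 in H by assumption; lra. }
repeat split; auto.
destruct (D s Is) as (d0 & d1 & d2).
assert (H := is_derive_constant_on I _ _ s _ oI Is C (is_derive_qdot _ _ _ _ _ d2 d0)).
rewrite B1 in H by assumption; lra.
Qed.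

Lemma cov_tangent I g s : open I -> arc_length_curve I g -> I s ->
  cov g (tangent g) s = qadd (qderiv (qderiv g) s) (g s).
Proof.
intros oI A Is.
destruct (arc_length_products I g s oI A Is) as (_ & _ & _ & H & _).
unfold cov, tangent; rewrite H.
generalize (qderiv (qderiv g) s) (g s); qcoords.
Qed.

(** * Left-translated Frenet frame *)

(** The logarithmic derivative: left translation by the inverse conj(g) carries the tangent space at
    g to the imaginary quaternions, a copy of R^3. *)
Definition lvel (g : R -> quat) (s : R) : quat := qmul (qconj (g s)) (qderiv g s).

Definition lacc (g : R -> quat) (s : R) : quat :=
  qmul (qconj (g s)) (qadd (qderiv (qderiv g) s) (g s)).

(** On orthogonal imaginary quaternions the product is the cross product; since [lacc] is not
    normalized, this is the pulled-back binormal scaled by the curvature. *)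
Definition lbin (g : R -> quat) (s : R) : quat := qmul (lvel g s) (lacc g s).

Lemma qconj_skew x y : qdot y x = 0 -> qmul (qconj x) y = qscal (-1) (qmul (qconj y) x).
Proof.
intros H; destruct x as [a b c d], y as [a' b' c' d']; unfold qdot in H; cbn in H.
cbv [qmul qconj qscal qre qi qj qk]; f_equal; lra.
Qed.

Lemma imag_sqr x : qre x = 0 -> qmul x x = qscal (- qdot x x) qone.
Proof.
destruct x as [a b c d]; cbn; intros ->; cbv [qmul qscal qdot qone qre qi qj qk]; f_equal; ring.
Qed.

(** Left translation by a unit quaternion is an isometry, and the real part of conj(x) y is
    <y,x>. *)
Lemma frame_products I g k s : open I -> arc_length_curve I g -> I s ->
  curvature g s = k ->
  qdot (lvel g s) (lvel g s) = 1 /\ qdot (lacc g s) (lacc g s) = k * k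
  /\ qdot (lvel g s) (lacc g s) = 0 /\ qre (lvel g s) = 0 /\ qre (lacc g s) = 0.
Proof.
intros oI A Is K.
destruct (arc_length_products I g s oI A Is) as (a0 & a1 & a2 & a3 & a4 & _).
unfold curvature in K; rewrite (cov_tangent I) in K by assumption.
unfold lvel, lacc; rewrite !qdot_qmul_l, qdot_qconj, a0, <- qnorm_sqr, <- (qnorm_sqr (qadd _ _)), K.
rewrite qdot_qadd_r, (qdotC _ (qderiv (qderiv g) s)), a4, a2.
assert (re : forall x y, qre (qmul (qconj x) y) = qdot y x) by qcoords.
rewrite !re, qdot_qadd_l, a0, a2, a3, qnorm_sqr, a1.
repeat split; ring.
Qed.

(** The term conj(g') g' equals 1 = conj(g) g, which supplies exactly the summand g in [lacc]. *)
Lemma lvel_deriv I g s : open I -> arc_length_curve I g -> I s ->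
  is_qderiv (lvel g) s (lacc g s).
Proof.
intros oI A Is.
destruct (arc_length_products I g s oI A Is) as (a0 & a1 & _).
destruct (arc_length_jet I g s A Is) as (d0 & d1 & _).
assert (H := is_qderiv_qmul _ _ _ _ _ (is_qderiv_qconj _ _ _ d0) d1); cbn beta in H.
replace (lacc g s) with
  (qadd (qmul (qconj (qderiv g s)) (qderiv g s)) (qmul (qconj (g s)) (qderiv (qderiv g) s)));
  [exact H|].
unfold lacc; rewrite qmul_qadd_r, !qmul_conj_l, a0, a1.
generalize (qmul (qconj (g s)) (qderiv (qderiv g) s)); qcoords.
Qed.

(** This is the Frenet equation for n multiplied by k. Constant curvature gives n = (g'' + g) / k
    along the whole interval, the projection in [cov] subtracts nothing because g''' + g' is
    orthogonal to g, and [binormal_eq] makes the binormal explicit. *)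
Lemma torsion_third_derivative I g k tau s : open I -> arc_length_curve I g -> I s ->
  k <> 0 -> (forall u, I u -> curvature g u = k) -> is_torsion g s tau ->
  qadd (qderiv (qderiv (qderiv g)) s) (qderiv g s)
  = qadd (qscal (- (k * k)) (qderiv g s))
         (qscal tau (qmul (qmul (qderiv g s) (qconj (g s)))
                          (qadd (qderiv (qderiv g) s) (g s)))).
Proof.
intros oI A Is kn0 K [b [[b0 [b1 [b2 [b3 pos]]]] T]].
destruct (arc_length_products I g s oI A Is) as (a0 & a1 & a2 & a3 & a4 & a5).
destruct (arc_length_jet I g s A Is) as (d0 & d1 & d2).
assert (Nu : forall u, I u ->
  normal g u = qscal (/ k) (qadd (qderiv (qderiv g) u) (g u))).
{ intros u Iu; unfold normal; rewrite K, (cov_tangent I) by assumption; reflexivity. }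
assert (dN : qderiv (normal g) s =
  qscal (/ k) (qadd (qderiv (qderiv (qderiv g)) s) (qderiv g s))).
{ apply is_qderiv_unique.
  eapply (is_qderiv_ext_open I); [exact oI|exact Is| |].
  { intros u Iu; symmetry; exact (Nu u Iu). }
  apply (is_qderiv_qscal (/ k) (fun u => qadd (qderiv (qderiv g) u) (g u))).
  now apply is_qderiv_qadd. }
assert (N2 : qdot (normal g s) (normal g s) = 1).
{ rewrite Nu, qdot_qscal_l, qdot_qscal_r, <- qnorm_sqr by assumption.
  rewrite <- (cov_tangent I) by assumption.
  fold (curvature g s); rewrite K by assumption; now field. }
unfold tangent in b2, pos, T.
assert (B : b = qmul (qmul (qderiv g s) (qconj (g s))) (normal g s)).
{ apply binormal_eq; try assumption.
  - now apply qnorm_1.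
  - now rewrite qdotC.
  - rewrite qdotC, Nu, qdot_qscal_l, qdot_qadd_l, a0, a3 by assumption; ring.
  - rewrite qdotC, Nu, qdot_qscal_l, qdot_qadd_l, a4, (qdotC (g s)), a2 by assumption; ring.
  - now rewrite qdotC.
  - now rewrite qdotC.
  - now rewrite qdotC. }
rewrite B in T; unfold cov in T.
rewrite K, dN, qdot_qscal_l, qdot_qadd_l, a5, a2, (Nu s Is), qmul_qscal_r in T by assumption.
revert T.
generalize (qadd (qderiv (qderiv (qderiv g)) s) (qderiv g s)).
generalize (qmul (qmul (qderiv g s) (qconj (g s))) (qadd (qderiv (qderiv g) s) (g s))).
generalize (qderiv g s) (g s); intros Z W Y X T.
replace X with (qscal k (qsub (qscal (/ k) X) (qscal (/ k * (0 + 0)) W))).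
{ rewrite T; destruct Y as [y0 y1 y2 y3], Z as [z0 z1 z2 z3].
  cbv [qadd qscal qre qi qj qk]; f_equal; now field. }
destruct X as [x0 x1 x2 x3], W as [w0 w1 w2 w3].
cbv [qadd qscal qsub qre qi qj qk]; f_equal; now field.
Qed.

(* The Frenet equations of the frame (g, t, n, b) pull back to those of a curve
   in R^3 with tangent [lvel g], curvature [k] and torsion [tau - 1]. *)
Lemma lacc_deriv I g k tau s : open I -> arc_length_curve I g -> I s ->
  k <> 0 -> (forall u, I u -> curvature g u = k) -> is_torsion g s tau ->
  is_qderiv (lacc g) s
    (qadd (qscal (- (k * k)) (lvel g s)) (qscal (tau - 1) (lbin g s))).
Proof.
intros oI A Is kn0 K T.
destruct (arc_length_products I g s oI A Is) as (a0 & a1 & a2 & _).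
destruct (arc_length_jet I g s A Is) as (d0 & d1 & d2).
assert (H := is_qderiv_qmul _ _ _ _ _ (is_qderiv_qconj _ _ _ d0)
  (is_qderiv_qadd _ _ _ _ _ d2 d0)); cbn beta in H.
rewrite (torsion_third_derivative I g k tau s) in H by assumption.
refine (eq_ind _ (is_qderiv (lacc g) s) H _ _).
(* The derivative of the inverse of g. It turns conj(g') (g'' + g) into [- lbin], which is the
   source of the shift from tau to tau - 1. *)
assert (E : qconj (qderiv g s) = qscal (-1) (qmul (qmul (qconj (g s)) (qderiv g s)) (qconj (g s)))).
{ rewrite (qconj_skew _ _ a2), qmul_qscal_l, <- qmulA, qmul_conj_r, a0.
  generalize (qconj (qderiv g s)); qcoords. }
rewrite E; unfold lbin, lvel, lacc.
rewrite (qmul_qadd_r _ (qscal _ _)), !qmul_qscal_r, !qmul_qscal_l, !qmulA.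
generalize (qmul (qmul (qmul (qconj (g s)) (qderiv g s)) (qconj (g s)))
        (qadd (qderiv (qderiv g) s) (g s))).
generalize (qmul (qconj (g s)) (qderiv g s)).
clear; qcoords.
Qed.

(** By the product rule, [lacc] squared gives -k^2 and the tangential part of the derivative of
    [lacc] gives +k^2. These cancel, and [lvel] squared being -1 leaves a multiple of [lacc]. *)
Lemma lbin_deriv I g k tau s : open I -> arc_length_curve I g -> I s ->
  k <> 0 -> (forall u, I u -> curvature g u = k) -> is_torsion g s tau ->
  is_qderiv (lbin g) s (qscal (- (tau - 1)) (lacc g s)).
Proof.
intros oI A Is kn0 K T.
destruct (frame_products I g k s oI A Is (K s Is)) as (p1 & p2 & p3 & p4 & p5).
assert (H := is_qderiv_qmul _ _ _ _ _ (lvel_deriv I g s oI A Is)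
  (lacc_deriv I g k tau s oI A Is kn0 K T)).
refine (eq_ind _ (is_qderiv (lbin g) s) H _ _).
unfold lbin; rewrite qmul_qadd_r, !qmul_qscal_r, qmulA.
rewrite !imag_sqr, p1, p2 by assumption.
generalize (lacc g s); qcoords.
Qed.

(** * The minimal surface equation *)

(** The second factor is translated on the right: X_s = alpha a beta and X_t = alpha b beta then
    compare a and b in the same space of imaginary quaternions. *)
Definition rvel (g : R -> quat) (t : R) : quat := qmul (qderiv g t) (qconj (g t)).

Definition racc (g : R -> quat) (t : R) : quat :=
  qmul (qadd (qderiv (qderiv g) t) (g t)) (qconj (g t)).

Lemma rvel_deriv J g t : open J -> arc_length_curve J g -> J t ->
  is_qderiv (rvel g) t (racc g t).
Proof.
intros oI A Is.
destruct (arc_length_products J g t oI A Is) as (a0 & a1 & _).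
destruct (arc_length_jet J g t A Is) as (d0 & d1 & _).
assert (H := is_qderiv_qmul _ _ _ _ _ d1 (is_qderiv_qconj _ _ _ d0)); cbn beta in H.
refine (eq_ind _ (is_qderiv (rvel g) t) H _ _).
unfold racc; rewrite qmul_qadd_l, !qmul_conj_r, a0, a1.
generalize (qmul (qderiv (qderiv g) t) (qconj (g t))); qcoords.
Qed.

Lemma rframe_products J g k t : open J -> arc_length_curve J g -> J t ->
  curvature g t = k ->
  qdot (rvel g t) (rvel g t) = 1 /\ qdot (racc g t) (racc g t) = k * k
  /\ qdot (rvel g t) (racc g t) = 0 /\ qre (rvel g t) = 0 /\ qre (racc g t) = 0.
Proof.
intros oI A Is K.
destruct (arc_length_products J g t oI A Is) as (a0 & a1 & a2 & a3 & a4 & _).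
unfold curvature in K; rewrite (cov_tangent J) in K by assumption.
unfold rvel, racc; rewrite !qdot_qmul_r, qdot_qconj, a0, <- qnorm_sqr, <- (qnorm_sqr (qadd _ _)), K.
rewrite qdot_qadd_r, (qdotC _ (qderiv (qderiv g) t)), a4, a2.
assert (re : forall x y, qre (qmul y (qconj x)) = qdot y x) by qcoords.
rewrite !re, qdot_qadd_l, a0, a2, a3, qnorm_sqr, a1.
repeat split; ring.
Qed.

Lemma is_qderiv_qmul_const_r f s v c : is_qderiv f s v ->
  is_qderiv (fun u => qmul (f u) c) s (qmul v c).
Proof.
intros H; refine (eq_ind _ (is_qderiv _ s)
  (is_qderiv_qmul f (fun _ => c) s v qzero H (is_qderiv_const c s)) _ _).
cbn; generalize (f s); clear; qcoords.
Qed.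

Lemma is_qderiv_qmul_const_l f s v c : is_qderiv f s v ->
  is_qderiv (fun u => qmul c (f u)) s (qmul c v).
Proof.
intros H; refine (eq_ind _ (is_qderiv _ s)
  (is_qderiv_qmul (fun _ => c) f s qzero v (is_qderiv_const c s) H) _ _).
cbn; generalize (f s); clear; qcoords.
Qed.

(** Here E = G = 1, and the radial parts removed by [cov] are multiples of X, which N
    annihilates. *)
Lemma translation_mean_curvature I J alpha beta s t N :
  open I -> open J -> arc_length_curve I alpha -> arc_length_curve J beta ->
  I s -> J t -> qdot N (translation alpha beta s t) = 0 ->
  let x := alpha s in let x1 := qderiv alpha s in let x2 := qderiv (qderiv alpha) s in
  let y := beta t in let y1 := qderiv beta t in let y2 := qderiv (qderiv beta) t in
  let F := qdot (qmul x1 y) (qmul x y1) in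
  d_s (translation alpha beta) s t = qmul x1 y /\
  d_t (translation alpha beta) s t = qmul x y1 /\
  mean_curvature (translation alpha beta) s t N
  = (qdot (qmul x2 y) N - 2 * F * qdot (qmul x1 y1) N + qdot (qmul x y2) N)
    / (2 * (1 - F * F)).
Proof.
intros oI oJ A B Is Jt NX x x1 x2 y y1 y2 F.
set (X := translation alpha beta) in *.
assert (ds : forall u v, I u -> d_s X u v = qmul (qderiv alpha u) (beta v)).
{ intros u v Iu; apply is_qderiv_unique, is_qderiv_qmul_const_r.
  exact (proj1 (arc_length_jet I alpha u A Iu)). }
assert (dt : forall u v, J v -> d_t X u v = qmul (alpha u) (qderiv beta v)).
{ intros u v Jv; apply is_qderiv_unique, is_qderiv_qmul_const_l.
  exact (proj1 (arc_length_jet J beta v B Jv)). }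
destruct (arc_length_jet I alpha s A Is) as (da0 & da1 & _).
destruct (arc_length_jet J beta t B Jt) as (db0 & db1 & _).
assert (dss : qderiv (fun u => d_s X u t) s = qmul x2 y).
{ apply is_qderiv_unique.
  apply (is_qderiv_ext_open I (fun u => qmul (qderiv alpha u) y)); try assumption.
  - intros u Iu; symmetry; now apply ds.
  - now apply is_qderiv_qmul_const_r. }
assert (dst : qderiv (fun u => d_t X u t) s = qmul x1 y1).
{ apply is_qderiv_unique.
  apply (is_qderiv_ext_open I (fun u => qmul (alpha u) y1)); try assumption.
  - intros u Iu; symmetry; now apply dt.
  - now apply is_qderiv_qmul_const_r. }
assert (dtt : qderiv (fun u => d_t X s u) t = qmul x y2).
{ apply is_qderiv_unique.
  apply (is_qderiv_ext_open J (fun u => qmul x (qderiv beta u))); try assumption.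
  - intros u Iu; symmetry; now apply dt.
  - now apply is_qderiv_qmul_const_l. }
destruct (arc_length_products I alpha s oI A Is) as (a0 & a1 & _).
destruct (arc_length_products J beta t oJ B Jt) as (b0 & b1 & _).
split; [now apply ds|split; [now apply dt|]].
unfold mean_curvature, cov.
rewrite dss, dst, dtt, (ds s t Is), (dt s t Jt), !qdot_qsub_l, !(qdot_qscal_l _ (X s t)).
rewrite (qdotC (X s t) N), NX.
fold x x1 y y1 F; rewrite qdot_qmul_l, qdot_qmul_r.
fold x in a0; fold x1 in a1; fold y in b0; fold y1 in b1.
rewrite a0, a1, b0, b1.
f_equal; ring.
Qed.

(** With a = [lvel alpha s] and b = [rvel beta t], the left side is - <a x a', b> + <a, b x b'> =
    <a' + b', a x b>, arranged so that for fixed t it is linear in the frame of alpha. *)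
Lemma minimal_equation I J alpha beta s t :
  open I -> open J -> arc_length_curve I alpha -> arc_length_curve J beta ->
  regular_surface I J (translation alpha beta) ->
  minimal I J (translation alpha beta) -> I s -> J t ->
  let F := qdot (lvel alpha s) (rvel beta t) in
  - qdot (lbin alpha s) (rvel beta t)
  + qdot (lvel alpha s) (qmul (racc beta t) (qconj (rvel beta t)))
  = 2 * F * (1 - F * F).
Proof.
intros oI oJ A B reg minim Is Jt F.
destruct (arc_length_products I alpha s oI A Is) as (a0 & a1 & a2 & a3 & a4 & _).
destruct (arc_length_products J beta t oJ B Jt) as (b0 & b1 & b2 & b3 & b4 & _).
assert (mc := fun N => translation_mean_curvature I J alpha beta s t N oI oJ A B Is Jt).
assert (rg := reg s t Is Jt).
assert (mn := minim s t Is Jt).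
destruct (frame_products I alpha _ s oI A Is eq_refl) as (_ & _ & _ & imL & _).
unfold lbin.
(* Left multiplication by an imaginary quaternion is skew-adjoint. *)
assert (skew : forall p q r, qre p = 0 -> qdot (qmul p q) r = - qdot q (qmul p r)).
{ intros [p0 p1 p2 p3] [] []; cbn; intros ->; unfold qdot; cbn; ring. }
rewrite (skew _ _ _ imL); clear skew imL.
unfold lacc, lvel, rvel, racc, translation, is_unit_normal in *; cbv zeta in mc.
revert F a0 a1 a2 a3 a4 b0 b1 b2 b3 b4 mc rg mn.
set (x := alpha s); set (x1 := qderiv alpha s); set (x2 := qderiv (qderiv alpha) s).
set (y := beta t); set (y1 := qderiv beta t); set (y2 := qderiv (qderiv beta) t).
intros F a0 a1 a2 a3 a4 b0 b1 b2 b3 b4 mc rg mn.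
set (F' := qdot (qmul x1 y) (qmul x y1)) in *.
assert (xx : qmul x (qconj x) = qone) by (rewrite qmul_conj_r, a0; apply qscal_1).
assert (yy : qmul (qconj y) y = qone) by (rewrite qmul_conj_l, b0; apply qscal_1).
assert (FF : F = F').
{ unfold F; rewrite qdot_conj_l, qdotC, qmulA, qdot_conj_r, qdotC; reflexivity. }
assert (ds : d_s (fun u v => qmul (alpha u) (beta v)) s t = qmul x1 y).
(* The formulas for the partial derivatives do not involve N, so the zero quaternion serves as
   one. *)
{ apply (mc qzero); unfold qdot, qzero; cbn; ring. }
assert (dt : d_t (fun u v => qmul (alpha u) (beta v)) s t = qmul x y1).
{ apply (mc qzero); unfold qdot, qzero; cbn; ring. }
rewrite ds, dt in rg, mn.
assert (posF : 0 < 1 - F' * F').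
(* Z is the component of X_s orthogonal to X_t; regularity forbids it to vanish. *)
{ set (Z := qadd (qscal 1 (qmul x1 y)) (qscal (- F') (qmul x y1))).
  assert (ZZ : qdot Z Z = 1 - F' * F').
  { unfold Z; rewrite qdot_qadd_l, !qdot_qadd_r, !qdot_qscal_l, !qdot_qscal_r.
    rewrite (qdotC (qmul x y1) (qmul x1 y)), qdot_qmul_l, qdot_qmul_r; fold F'.
    rewrite a0, a1, b0, b1; ring. }
  destruct (Rle_lt_or_eq_dec _ _ (qdot_self_ge0 Z)) as [H|H]; [lra|].
  assert (Z0 : Z = qzero) by now apply qdot_self_eq0.
  destruct (rg 1 (- F') Z0); lra. }
(* Since a b = a x b - <a,b>, this is alpha (a x b) beta, a normal vector whose squared length is 1
   - F^2. *)
set (M := qadd (qmul x1 y1) (qscal F' (qmul x y))).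
assert (e := qdot_exchange x x1 y y1); fold F' in e; rewrite a2, b2 in e.
assert (MX : qdot M (qmul x y) = 0).
{ unfold M; rewrite qdot_qadd_l, qdot_qscal_l, qdot_qmul_l, a0, b0; lra. }
assert (Ms : qdot M (qmul x1 y) = 0).
{ unfold M; rewrite qdot_qadd_l, qdot_qscal_l, qdot_qmul_l, qdot_qmul_r, (qdotC x), a2, b2; ring. }
assert (Mt : qdot M (qmul x y1) = 0).
{ unfold M; rewrite qdot_qadd_l, qdot_qscal_l, qdot_qmul_l, qdot_qmul_r, (qdotC y), a2, b2; ring. }
assert (Mst : qdot M (qmul x1 y1) = 1 - F' * F').
{ unfold M; rewrite qdot_qadd_l, qdot_qscal_l, qdot_qmul_l, a1, b1, (qdotC (qmul x y)); nra. }
assert (MM : qdot M M = 1 - F' * F').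
{ unfold M at 2; rewrite qdot_qadd_r, qdot_qscal_r, MX, Mst; ring. }
(* The F-term of M contributes F <x2,x> = -F, which is also <x y, x1 y1>; hence x2 becomes x2 +
   x. *)
assert (Mss : qdot M (qmul x2 y) = qdot (qmul (qadd x2 x) y) (qmul x1 y1)).
{ rewrite qmul_qadd_l, qdot_qadd_l; unfold M.
  rewrite qdot_qadd_l, qdot_qscal_l, qdot_qmul_r, (qdotC x x2), b0, a3.
  rewrite (qdotC (qmul x1 y1) (qmul x2 y)), (qdotC (qmul x y) (qmul x1 y1)); lra. }
assert (Mtt : qdot M (qmul x y2) = qdot (qmul x (qadd y2 y)) (qmul x1 y1)).
{ rewrite qmul_qadd_r, qdot_qadd_l; unfold M.
  rewrite qdot_qadd_l, qdot_qscal_l, qdot_qmul_l, (qdotC y y2), a0, b3.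
  rewrite (qdotC (qmul x1 y1) (qmul x y2)), (qdotC (qmul x y) (qmul x1 y1)); lra. }
set (m := sqrt (1 - F' * F')).
assert (m0 : 0 < m) by now apply sqrt_lt_R0.
assert (mm : m * m = 1 - F' * F') by (apply sqrt_sqrt; lra).
assert (NX : qdot (qscal (/ m) M) (qmul x y) = 0) by (rewrite qdot_qscal_l, MX; ring).
assert (H : mean_curvature (fun u v => qmul (alpha u) (beta v)) s t (qscal (/ m) M) = 0).
{ apply mn; rewrite !qdot_qscal_l, MX, Ms, Mt; repeat split; try ring.
  unfold qnorm; rewrite qdot_qscal_l, qdot_qscal_r, MM, <- mm.
  rewrite <- sqrt_1; f_equal; field; lra. }
destruct (mc _ NX) as (_ & _ & E); rewrite E in H; clear E.
rewrite !qdot_qscal_r, !(qdotC _ M), Mss, Mtt, Mst in H.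
assert (Q : qdot (qmul (qadd x2 x) y) (qmul x1 y1) + qdot (qmul x (qadd y2 y)) (qmul x1 y1)
  = 2 * F' * (1 - F' * F')).
{ apply (f_equal (fun r => r * (2 * (1 - F' * F') * m))) in H.
  rewrite Rmult_0_l in H.
  assert (H2 : forall p q, (/ m * p - 2 * F' * (/ m * (1 - F' * F')) + / m * q)
     / (2 * (1 - F' * F')) * (2 * (1 - F' * F') * m) = p + q - 2 * F' * (1 - F' * F'))
   by (intros; field; lra).
  rewrite H2 in H; lra. }
rewrite FF, <- Q, Ropp_involutive.
f_equal.
- rewrite qdot_conj_l, !qmulA, xx, qmul_1_l, qdotC, qdot_conj_r; apply qdotC.
- rewrite qdot_conj_l, qdotC.
  replace (qconj (qmul y1 (qconj y))) with (qmul y (qconj y1)) by (clear; generalize y y1; qcoords).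
  rewrite <- (qmulA (qadd y2 y)), (qmulA (qconj y)), yy, qmul_1_l, qmulA, qdot_conj_r.
  reflexivity.
Qed.

(** * The cubic resonance *)

(* [D^3 + w^2 D], with [w^2 = k^2 + c^2], kills [x], [z] and [l], and maps
   [x^3] to [6 y (y^2 - 3 x v)] where [v = k^2 x - c z = - x'']. *)
Lemma linear_eq_cubic_imp_constant (I : R -> Prop) (x y z l m n : R -> R) (k c : R) :
  open I -> k <> 0 ->
  (forall u, I u -> is_derive x u (y u)) ->
  (forall u, I u -> is_derive y u (- (k * k) * x u + c * z u)) ->
  (forall u, I u -> is_derive z u (- c * y u)) ->
  (forall u, I u -> is_derive l u (m u)) ->
  (forall u, I u -> is_derive m u (- (k * k) * l u + c * n u)) ->
  (forall u, I u -> is_derive n u (- c * m u)) ->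
  (forall u, I u -> - z u + l u = 2 * x u * (1 - x u * x u)) ->
  forall u, I u -> y u = 0.
Proof.
intros oI kn0 dx dy dz dl dm dn E.
assert (step : forall f d, (forall u, I u -> f u = 0) ->
  forall u, I u -> is_derive f u d -> d = 0)
  by (intros f d H u Iu; exact (is_derive_constant_on I f 0 u d oI Iu H)).
set (v := fun u => k * k * x u - c * z u).
assert (E1 : forall u, I u ->
  c * y u + m u - 2 * y u + 6 * (x u * x u * y u) = 0).
{ intros u Iu; specialize (dx u Iu); specialize (dz u Iu); specialize (dl u Iu).
  apply (step (fun u => - 1 * z u + l u - 2 * x u + 2 * (x u * x u * x u))) with u; [|exact Iu|].
  - intros r Ir; specialize (E r Ir); lra.
  - eapply is_derive_eq; [deriv|]; unfold plus, minus, opp, zero; cbn; ring. }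
assert (E2 : forall u, I u ->
  - c * v u + (- (k * k) * l u + c * n u) + 2 * v u
  + 12 * (x u * (y u * y u)) - 6 * (x u * x u * v u) = 0).
{ intros u Iu; specialize (dx u Iu); specialize (dy u Iu); specialize (dm u Iu).
  apply (step _ _ E1 u Iu).
  eapply is_derive_eq; [deriv|]; unfold v, plus, minus, opp, zero; cbn; ring. }
assert (E3 : forall u, I u -> y u * (y u * y u - 3 * (x u * v u)) = 0).
{ intros u Iu; specialize (E1 u Iu); specialize (dx u Iu); specialize (dy u Iu);
  specialize (dz u Iu); specialize (dl u Iu); specialize (dn u Iu).
  (* The third derivative of the relation; adding k^2 + c^2 times the first derivative [E1] cancels
     every linear term. *)
  assert (H : - c * ((k * k + c * c) * y u) - (k * k + c * c) * m u
    + 2 * (k * k + c * c) * y u + 12 * (y u * y u * y u) - 36 * (x u * y u * v u)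
    - 6 * (k * k + c * c) * (x u * x u * y u) = 0).
  { apply (step _ _ E2 u Iu); unfold v.
    eapply is_derive_eq; [deriv|]; unfold plus, minus, opp, zero; cbn; ring. }
  apply (f_equal (Rmult (k * k + c * c))) in E1; lra. }
assert (E4 : forall u, I u ->
  y u * y u * y u * (5 * v u + 3 * ((k * k + c * c) * x u)) = 0).
{ intros u Iu; assert (H3 := E3 u Iu); specialize (dx u Iu); specialize (dy u Iu);
  specialize (dz u Iu).
  assert (H : - v u * (y u * y u - 3 * (x u * v u))
    - y u * y u * (5 * v u + 3 * ((k * k + c * c) * x u)) = 0).
  { apply (step _ _ E3 u Iu); unfold v.
    eapply is_derive_eq; [deriv|]; unfold plus, minus, opp, zero; cbn; ring. }
  (* After multiplication by y, the term still carrying the factor y^2 - 3 x v vanishes by [E3]. *)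
  apply (f_equal (Rmult (y u))) in H; apply (f_equal (Rmult (v u))) in H3; lra. }
intros u Iu; assert (H4 := E4 u Iu); specialize (dx u Iu); specialize (dy u Iu);
specialize (dz u Iu).
assert (H : - (3 * (y u * y u) * v u * (5 * v u + 3 * ((k * k + c * c) * x u)))
  + 8 * (k * k + c * c) * (y u * y u * y u * y u) = 0).
{ apply (step _ _ E4 u Iu); unfold v.
  eapply is_derive_eq; [deriv|]; unfold plus, minus, opp, zero; cbn; ring. }
(* The same elimination, now using [E4], leaves 8 (k^2 + c^2) y^5 = 0. *)
apply (f_equal (Rmult (y u))) in H; apply (f_equal (Rmult (3 * v u))) in H4.
assert (Y : (k * k + c * c) * (y u ^ 5) = 0) by lra.
apply Rmult_integral in Y; destruct Y as [Y|Y]; [nra|].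
destruct (Req_dec (y u) 0) as [|ne]; [assumption|].
exfalso; exact (pow_nonzero _ 5 ne Y).
Qed.

(** * The contradiction among orthogonal vectors in R^3 *)

Theorem theorem6p2 :
  ~ exists (I J : R -> Prop) (alpha beta : R -> quat),
      is_open_interval I /\ is_open_interval J
      /\ arc_length_curve I alpha /\ arc_length_curve J beta
      /\ regular_surface I J (translation alpha beta)
      /\ minimal I J (translation alpha beta)
      /\ exists k_alpha k_beta tau_alpha tau_beta : R,
           k_alpha <> 0 /\ k_beta <> 0
           /\ (forall s, I s -> curvature alpha s = k_alpha)
           /\ (forall t, J t -> curvature beta t = k_beta)
           /\ (forall s, I s -> is_torsion alpha s tau_alpha)
           /\ (forall t, J t -> is_torsion beta t tau_beta).
Proof.
intros (I & J & alpha & beta & (oI & (s & Is) & _) & (oJ & (t & Jt) & _) & A & B & reg & minim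
  & k & k' & tau & _ & kn0 & kn0' & K & K' & T & _).
set (c := tau - 1).
set (V := fun u => qadd (qscal (- (k * k)) (lvel alpha u)) (qscal c (lbin alpha u))).
assert (da : forall u, I u -> is_qderiv (lvel alpha) u (lacc alpha u))
  by (intros; now apply (lvel_deriv I)).
assert (dp : forall u, I u -> is_qderiv (lacc alpha) u (V u))
  by (intros; apply (lacc_deriv I); auto).
assert (dr : forall u, I u -> is_qderiv (lbin alpha) u (qscal (- c) (lacc alpha u)))
  by (intros; apply (lbin_deriv I _ k); auto).
assert (Pb : forall u v, I u -> J v -> qdot (lacc alpha u) (rvel beta v) = 0).
{ intros u v Iu Jv; revert u Iu.
  (* As b is imaginary, q is the cross product of b and b'. With v fixed, products with b and with q
     satisfy the same linear system in u. *)
  set (b := rvel beta v); set (q := qmul (racc beta v) (qconj (rvel beta v))).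
  assert (dV : forall w u, I u -> is_derive (fun u => qdot (lacc alpha u) w) u
    (- (k * k) * qdot (lvel alpha u) w + c * qdot (lbin alpha u) w)).
  { intros w u Iu; rewrite <- !qdot_qscal_l, <- qdot_qadd_l.
    now apply is_derive_qdot_const, dp. }
  assert (dR : forall w u, I u -> is_derive (fun u => qdot (lbin alpha u) w) u
    (- c * qdot (lacc alpha u) w)).
  { intros w u Iu; rewrite <- qdot_qscal_l; now apply is_derive_qdot_const, dr. }
  assert (dA : forall w u, I u -> is_derive (fun u => qdot (lvel alpha u) w) u
    (qdot (lacc alpha u) w)).
  { intros w u Iu; now apply is_derive_qdot_const, da. }
  apply (linear_eq_cubic_imp_constant I
    (fun u => qdot (lvel alpha u) b) (fun u => qdot (lacc alpha u) b)
    (fun u => qdot (lbin alpha u) b) (fun u => qdot (lvel alpha u) q)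
    (fun u => qdot (lacc alpha u) q) (fun u => qdot (lbin alpha u) q) k c); auto.
  intros u Iu; now apply (minimal_equation I J). }
assert (Vb : forall v, J v -> qdot (V s) (rvel beta v) = 0).
{ intros v Jv.
  apply (is_derive_constant_on I (fun u => qdot (lacc alpha u) (rvel beta v)) 0 s); auto.
  now apply is_derive_qdot_const, dp. }
(* Orthogonality to the whole curve [rvel beta] passes to its derivative at t. *)
assert (dual : forall w, (forall v, J v -> qdot w (rvel beta v) = 0) ->
  qdot w (racc beta t) = 0).
{ intros w H; rewrite qdotC.
  apply (is_derive_constant_on J (fun v => qdot (rvel beta v) w) 0 t); auto.
  - intros v Jv; rewrite qdotC; auto.
  - now apply is_derive_qdot_const, (rvel_deriv J). }
assert (Pb' : qdot (lacc alpha s) (racc beta t) = 0) by auto.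
assert (Vb' := dual _ Vb).
destruct (frame_products I alpha k s oI A Is (K s Is)) as (p1 & p2 & p3 & p4 & p5).
destruct (rframe_products J beta k' t oJ B Jt (K' t Jt)) as (r1 & r2 & r3 & r4 & r5).
assert (q0 : forall w, qdot qone w = qre w) by (intros; unfold qdot; cbn; ring).
assert (RP : qdot (lbin alpha s) (lacc alpha s) = 0).
{ unfold lbin; rewrite <- (qmul_1_l (lacc alpha s)) at 2.
  rewrite qdot_qmul_r, (qdotC _ qone), q0, p4; ring. }
assert (RA : qdot (lvel alpha s) (lbin alpha s) = 0).
{ unfold lbin; rewrite <- (qmul_1_r (lvel alpha s)) at 1.
  rewrite qdot_qmul_l, q0, p5; ring. }
assert (RR : qdot (lbin alpha s) (lbin alpha s) = k * k)
  by (unfold lbin; rewrite qdot_qmul_l, p1, p2; ring).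
assert (PV : qdot (lacc alpha s) (V s) = 0).
{ unfold V; rewrite qdot_qadd_r, !qdot_qscal_r, (qdotC _ (lvel alpha s)), p3,
    (qdotC _ (lbin alpha s)), RP; ring. }
assert (VV : qdot (V s) (V s) = (k * k) * (k * k + c * c)).
{ unfold V; rewrite qdot_qadd_r, !qdot_qadd_l, !qdot_qscal_r, !qdot_qscal_l,
    (qdotC (lbin alpha s) (lvel alpha s)), RA, p1, RR; ring. }
assert (V0 : qdot qone (V s) = 0).
{ assert (im : forall x y, qre x = 0 -> qre (qmul x y) = - qdot x y).
  { intros [] [] H; cbn in H; subst; unfold qdot; cbn; ring. }
  unfold V, lbin.
  rewrite qdot_qadd_r, !qdot_qscal_r, !q0, (im _ _ p4), p3, p4; ring. }
assert (P0 : qdot qone (lacc alpha s) = 0) by now rewrite q0.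
assert (b0 : qdot qone (rvel beta t) = 0) by now rewrite q0.
assert (b0' : qdot qone (racc beta t) = 0) by now rewrite q0.
assert (Pbt := Pb s t Is Jt); assert (Vbt := Vb t Jt).
(* Both [rvel beta t] and [racc beta t] span the line orthogonal to
   [qone], [lacc alpha s] and [V s], yet they are orthogonal to each other. *)
assert (D1 := qdet_mul_orthogonal _ _ _ _ (rvel beta t) P0 V0 PV b0 Pbt Vbt).
assert (D2 := qdet_mul_orthogonal _ _ _ _ (racc beta t) P0 V0 PV b0' Pb' Vb').
assert (D3 := qdet_mul_orthogonal _ _ _ _ (racc beta t) P0 V0 PV b0 Pbt Vbt).
rewrite r1 in D1; rewrite r2 in D2; rewrite r3, Rmult_0_r in D3.
rewrite q0, p2, VV in D1, D2; cbn [qone qre] in D1, D2.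
assert (k2 : 0 < k * k) by nra.
assert (k2' : 0 < k' * k') by nra.
assert (w2 : 0 < k * k * (k * k + c * c)) by nra.
assert (pos := Rmult_lt_0_compat _ _ k2 w2).
(* One of the two determinants vanishes, yet [D1] and [D2] give their squares as positive
   numbers. *)
apply Rmult_integral in D3; destruct D3 as [D3|D3].
- rewrite D3 in D1; lra.
- rewrite D3 in D2; assert (pos' := Rmult_lt_0_compat _ _ pos k2'); lra.
Qed.
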